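(* For every $\mu>0$, the Lorentzian Lie algebra $(\mathfrak h_3\oplus\mathbb R,S_\mu,J)$ is flat with respect to the Kobayashi-Nomizu connection $\nabla^1$, i.e. $R^1_{uv}w=0$ for all $u,v,w\in\mathfrak h_3\oplus\mathbb R$.
   Context: $\mathfrak h_3\oplus\mathbb R$ is the real Lie algebra with basis $e_1,e_2,e_3,e_4$ and only non-zero bracket (up to skew-symmetry) $[e_1,e_2]=e_3$. For $\mu>0$, $S_\mu$ is the Lorentzian inner product $\langle\cdot,\cdot\rangle$ whose matrix in $(e_1,e_2,e_3,e_4)$ is $\operatorname{diag}(1,-1,\mu,1)$. Fix the basis $v_1=e_1$, $v_2=\frac1{\sqrt\mu}e_3$, $v_3=e_4$, $v_4=e_2$, which is orthonormal: $\langle v_i,v_j\rangle=0$ for $i\ne j$, $\langle v_i,v_i\rangle=1$ for $i=1,2,3$, $\langle v_4,v_4\rangle=-1$. The product structure $J$ is the linear map with $Jv_i=v_i$ for $i=1,2,3$ and $Jv_4=-v_4$. Write $\mathfrak g$ for the Lie algebra. The Levi-Civita connection is the bilinear map $\nabla:\mathfrak g\times\mathfrak g\to\mathfrak g$ with $2\langle\nabla_uv,w\rangle=\langle[u,v],w\rangle+\langle[w,u],v\rangle+\langle[w,v],u\rangle$ for all $u,v,w$. Put $(\nabla_uJ)v=\nabla_u(Jv)-J(\nabla_uv)$. The canonical connection is $\nabla^0_uv=\nabla_uv-\frac12(\nabla_uJ)Jv$, the Kobayashi-Nomizu connection is $\nabla^1_uv=\nabla^0_uv-\frac14\left[(\nabla_vJ)Ju-(\nabla_{Jv}J)u\right]$,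 and the curvature of $\nabla^1$ is $R^1_{uv}w=\nabla^1_{[u,v]}w-\nabla^1_u\nabla^1_vw+\nabla^1_v\nabla^1_uw$. *)

(* Defs.v *)
From HB Require Import structures.
From mathcomp Require Import all_boot all_order all_algebra.
From mathcomp Require Import reals.
From mathcomp Require Import ring.

Set Implicit Arguments.
Unset Strict Implicit.
Unset Printing Implicit Defensive.

Import Order.TTheory GRing.Theory Num.Theory.
Local Open Scope ring_scope.

Section Connections.
Context {R : realType} {V : lmodType R}.
Implicit Types (br D : V -> V -> V) (J : V -> V) (u v w : V).

Definition koszul br (g : V -> V -> R) D : Prop := forall u v w,
  2 * g (D u v) w = g (br u v) w + g (br w u) v + g (br w v) u.

(* covJ D J u v is (D_u J) v. *)
Definition covJ D J u v : V := D u (J v) - J (D u v).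

Definition canonical_conn D J u v : V :=
  D u v - 2^-1 *: covJ D J u (J v).

Definition kn_conn D J u v : V :=
  canonical_conn D J u v - 4^-1 *: (covJ D J v (J u) - covJ D J (J v) u).

Definition curvature br D u v w : V :=
  D (br u v) w - D u (D v w) + D v (D u w).

Definition flat br D : Prop := forall u v w, curvature br D u v w = 0.

End Connections.

Section H3R.
Context {R : realType}.
Local Notation g := 'rV[R]_4.
Implicit Types (mu : R) (u v w : g).

Definition e1 : g := delta_mx 0 0.
Definition e2 : g := delta_mx 0 1.
Definition e3 : g := delta_mx 0 2.
Definition e4 : g := delta_mx 0 3.

(* Coordinates are numbered from 0: the e_k-coordinate of u is u 0 (k - 1). *)
Definition bracket u v : g := (u 0 0 * v 0 1 - u 0 1 * v 0 0) *: e3.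

Definition S_mx mu : 'M[R]_4 :=
  diag_mx (\row_(i < 4) [:: 1; -1; mu; 1]`_i).
Definition S_form mu u v : R := (u *m S_mx mu *m v^T) 0 0.

Definition v1 : g := e1.
Definition v2 mu : g := (Num.sqrt mu)^-1 *: e3.
Definition v3 : g := e4.
Definition v4 : g := e2.

(* v1, ..., v4 is a basis when 0 < mu, so this determines the linear map J. *)
Definition product_structure mu (J : {linear g -> g}) : Prop :=
  [/\ J v1 = v1, J (v2 mu) = v2 mu, J v3 = v3 & J v4 = - v4].

Lemma ord4P (P : 'I_4 -> Prop) : P 0 -> P 1 -> P 2 -> P 3 -> forall i, P i.
Proof.
move=> P0 P1 P2 P3 [[|[|[|[|//]]]] p].
- by rewrite (_ : Ordinal p = 0) //; apply/val_inj.
- by rewrite (_ : Ordinal p = 1) //; apply/val_inj.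
- by rewrite (_ : Ordinal p = 2) //; apply/val_inj.
- by rewrite (_ : Ordinal p = 3) //; apply/val_inj.
Qed.

Lemma S_formE mu u v : S_form mu u v =
  u 0 0 * v 0 0 - u 0 1 * v 0 1 + mu * u 0 2 * v 0 2 + u 0 3 * v 0 3.
Proof.
rewrite /S_form /S_mx mul_mx_diag mxE !big_ord_recl big_ord0 !mxE /=.
rewrite (_ : lift ord0 ord0 = 1 :> 'I_4); last exact/val_inj.
rewrite (_ : lift ord0 (lift ord0 ord0) = 2 :> 'I_4); last exact/val_inj.
rewrite (_ : lift ord0 (lift ord0 (lift ord0 ord0)) = 3 :> 'I_4);
  last exact/val_inj.
by rewrite (_ : ord0 = 0 :> 'I_4) //=; ring.
Qed.

Lemma bracket_e :
  [/\ bracket e1 e2 = e3, bracket e1 e3 = 0, bracket e1 e4 = 0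
    & [/\ bracket e2 e3 = 0, bracket e2 e4 = 0 & bracket e3 e4 = 0]].
Proof.
by split; last split; rewrite /bracket !mxE /=
  ?(mulr0, mul0r, mulr1, subr0, scale1r, scale0r).
Qed.

Lemma bracketC u v : bracket u v = - bracket v u.
Proof. by rewrite /bracket -scaleNr; congr (_ *: _); ring. Qed.

Lemma bracket_jacobi u v w :
  bracket u (bracket v w) + bracket v (bracket w u) + bracket w (bracket u v)
  = 0.
Proof.
rewrite /bracket !mxE /= -!scalerDl; set c := (c in c *: _).
by rewrite (_ : c = 0) ?scale0r // /c; ring.
Qed.

Lemma bracket_is_bilinear : bilinear_for *:%R *:%R bracket.
Proof.
by split=> z a x y; rewrite /= /bracket scalerA -scalerDl; congr (_ *: _);
  rewrite !mxE; ring.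
Qed.

Definition lc mu u v : g :=
  (mu / 2 * (u 0 1 * v 0 2 + u 0 2 * v 0 1)) *: e1
  + (mu / 2 * (u 0 0 * v 0 2 + u 0 2 * v 0 0)) *: e2
  + (2^-1 * (u 0 0 * v 0 1 - u 0 1 * v 0 0)) *: e3.

Lemma lc_is_bilinear mu : bilinear_for *:%R *:%R (lc mu).
Proof.
by split=> z a x y; apply/rowP; apply: ord4P; rewrite /= /lc !mxE /=; ring.
Qed.

HB.instance Definition _ mu := bilinear_isBilinear.Build R g g g *:%R *:%R
  (lc mu) (lc_is_bilinear mu).

Lemma koszul_lc mu : koszul bracket (S_form mu) (lc mu).
Proof. by move=> u v w; rewrite !S_formE /bracket /lc !mxE /=; field. Qed.

Lemma S_form_nondegenerate mu : 0 < mu ->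
  forall u v, (forall w, S_form mu u w = S_form mu v w) -> u = v.
Proof.
move=> mu0 u v uv; have mun : mu != 0 by rewrite gt_eqF.
have := (uv e1, uv e2, uv e3, uv e4); rewrite !S_formE !mxE /=.
rewrite !(mulr0, mulr1, subr0, addr0, add0r, sub0r) => -[[[h0 h1] h2] h3].
apply/rowP; apply: ord4P => //; first exact: oppr_inj.
exact: (mulfI mun).
Qed.

Lemma koszul_unique mu (D : g -> g -> g) : 0 < mu ->
  koszul bracket (S_form mu) D -> forall u v, D u v = lc mu u v.
Proof.
move=> mu0 kD u v; apply: (S_form_nondegenerate mu0) => w.
by apply: (@mulfI _ 2); rewrite ?pnatr_eq0 // kD koszul_lc.
Qed.

Lemma koszul_exists mu :
  exists D : {bilinear g -> g -> g}, koszul bracket (S_form mu) D.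
Proof. by exists (lc mu); exact: koszul_lc. Qed.

Lemma product_structureE mu (J : {linear g -> g}) : 0 < mu ->
  product_structure mu J ->
  forall u, J u = u *m diag_mx (\row_(i < 4) [:: 1; -1; 1; 1]`_i).
Proof.
move=> mu0 [J1 J2 J3 J4] u.
have s0 : Num.sqrt mu != 0 by rewrite gt_eqF // sqrtr_gt0.
have Je3 : J e3 = e3.
  by apply: (scalerI (invr_neq0 s0)); rewrite -linearZ.
have uE : u = u 0 0 *: e1 + u 0 1 *: e2 + u 0 2 *: e3 + u 0 3 *: e4.
  by apply/rowP; apply: ord4P; rewrite !mxE /=; ring.
rewrite {1}uE !linearD !linearZ /= J1 J4 Je3 J3.
apply/rowP; apply: ord4P; rewrite mul_mx_diag !mxE /=; ring.
Qed.

Lemma product_structure_exists mu :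
  exists J : {linear g -> g}, product_structure mu J.
Proof.
exists (mulmxr (diag_mx (\row_(i < 4) [:: 1; -1; 1; 1]`_i))).
by split; rewrite /v2 /=; apply/rowP; apply: ord4P;
  rewrite mul_mx_diag !mxE /=; ring.
Qed.

Lemma v_orthonormal mu : 0 < mu ->
  [/\ S_form mu v1 v1 = 1, S_form mu (v2 mu) (v2 mu) = 1, S_form mu v3 v3 = 1
    & S_form mu v4 v4 = -1] /\
  [/\ S_form mu v1 (v2 mu) = 0, S_form mu v1 v3 = 0, S_form mu v1 v4 = 0
    & [/\ S_form mu (v2 mu) v3 = 0, S_form mu (v2 mu) v4 = 0 & S_form mu v3 v4 = 0]].
Proof.
move=> mu0; have s0 : Num.sqrt mu != 0 by rewrite gt_eqF // sqrtr_gt0.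
have mE : mu = Num.sqrt mu ^+ 2 by rewrite sqr_sqrtr // ltW.
split; split; last split; rewrite S_formE /v2 !mxE /=; try ring.
by move: (Num.sqrt mu) s0 mE => s s0 ->; field.
Qed.

End H3R.

(* Main.v *)
Require Import Defs.
From mathcomp Require Import all_boot all_order all_algebra.
From mathcomp Require Import reals.
From mathcomp Require Import ring.

Import GRing.Theory Num.Theory.
Local Open Scope ring_scope.

(** The Kobayashi-Nomizu connection has the single nonzero coefficient
    [nabla^1_{e2} e1 = - e3]. Since [nabla^1_u v] and [[u, v]] lie on the line
    of [e3], which [nabla^1] annihilates in either argument, each of the three
    terms of the curvature vanishes. *)

Lemma kn_connE {R : realType} {mu : R} (mu_gt0 : 0 < mu)
    {J : {linear 'rV[R]_4 -> 'rV[R]_4}} (J_prod : product_structure mu J)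
    {D : 'rV[R]_4 -> 'rV[R]_4 -> 'rV[R]_4}
    (D_LC : koszul bracket (S_form mu) D) (u v : 'rV[R]_4) :
  kn_conn D J u v = - (u 0 1 * v 0 0) *: e3.
Proof.
(* Each v_i is a multiple of some e_k, so [J] is diagonal in the e_k as well, with its only sign
   change at e_2 = v_4. *)
have JE w i : J w 0 i = w 0 i * [:: 1; -1; 1; 1]`_i.
  by rewrite (product_structureE mu_gt0 J_prod) mul_mx_diag !mxE.
rewrite /kn_conn /canonical_conn /covJ !(koszul_unique mu_gt0 D_LC).
(* Here nabla^0_u v = (mu/2) u_2 v_3 e_3-free part along e_1, minus (1/2) u_2 v_1 e_3; the
   correction subtracts (mu/2) u_2 v_3 e_1 + (1/2) u_2 v_1 e_3, so mu cancels. *)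
by apply/rowP; apply: ord4P; rewrite !(JE, mxE) /=; field.
Qed.

Theorem theorem4p4 (R : realType) (mu : R) (mu_gt0 : 0 < mu)
    (J : {linear 'rV[R]_4 -> 'rV[R]_4})
    (J_prod : product_structure mu J)
    (nabla : {bilinear 'rV[R]_4 -> 'rV[R]_4 -> 'rV[R]_4})
    (nabla_LC : koszul bracket (S_form mu) nabla) :
  flat bracket (kn_conn nabla J).
Proof.
move=> u v w; rewrite /curvature !(kn_connE mu_gt0 J_prod nabla_LC).
(* The vanishing factors are the e_2-coordinate of [bracket u v] and the e_1-coordinates of
   nabla^1_v w and nabla^1_u w. *)
by rewrite /bracket !mxE /= !(mulr0, mul0r, oppr0, scale0r, addr0).
Qed.
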